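(* Every almost-CL-space $X$ admitting a smooth point (in particular, every separable almost-CL-space) has the Mazur-Ulam property.
   Context: All spaces are over the real field. For a Banach space $X$, $B_X$ and $S_X$ are its closed unit ball and unit sphere. A convex subset $C$ of $S_X$ is a maximal convex subset of $S_X$ if it is not properly contained in any other convex subset of $S_X$. A Banach space $X$ is an almost-CL-space if for every maximal convex subset $C$ of $S_X$ one has $B_X=\overline{\mathrm{co}}(C\cup -C)$ (closed convex hull). A point $x\in S_X$ is a smooth point if there is exactly one $f\in S_{X^*}$ with $f(x)=1$. An almost-CL-space $X$ is said to admit a smooth point if every maximal convex subset $C$ of $S_X$ contains a smooth point. A Banach space $X$ has the Mazur-Ulam property (MUP) if for every Banach space $Y$, every surjective isometry $T:S_X\to S_Y$ between the unit spheres is the restriction of a linear isometry between the two spaces $X$ and $Y$. *)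

(* Defs.v *)
From HB Require Import structures.
From mathcomp Require Import all_boot all_order all_algebra.
From mathcomp Require Import all_classical all_reals all_analysis.

Set Implicit Arguments.
Unset Strict Implicit.
Unset Printing Implicit Defensive.

Import Order.TTheory GRing.Theory Num.Theory.
Import numFieldNormedType.Exports.

Local Open Scope classical_set_scope.
Local Open Scope ring_scope.

Definition unit_ball (R : realType) (X : normedModType R) : set X :=
  [set x | `|x| <= 1].
Arguments unit_ball {R} X.

Definition unit_sphere (R : realType) (X : normedModType R) : set X :=
  [set x | `|x| = 1].
Arguments unit_sphere {R} X.

Definition maximal_convex_of_sphere (R : realType) (X : normedModType R)
    (C : set X) : Prop :=
  [/\ C `<=` unit_sphere X, @convex_set R X C
    & forall D : set X, D `<=` unit_sphere X -> @convex_set R X D ->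
        ~ (C `<` D)].

Definition convex_hull (R : realType) (X : normedModType R) (A : set X) :
    set X :=
  smallest (@convex_set R X) A.

Definition almost_CL_space (R : realType) (X : normedModType R) : Prop :=
  forall C : set X, maximal_convex_of_sphere C ->
    unit_ball X = closure (convex_hull (C `|` (-%R @` C))).

(* [sup] is 0 on sets without an upper bound, so this is the dual norm only
   for bounded functionals; [dual_unit_sphere] asks for continuity. *)
Definition dual_norm (R : realType) (X : normedModType R) (f : X -> R^o) : R :=
  sup [set `|f x| | x in unit_ball X].

Definition dual_unit_sphere (R : realType) (X : normedModType R) :
    set (X -> R^o) :=
  [set f | [/\ linear f, continuous f & dual_norm f = 1]].
Arguments dual_unit_sphere {R} X.

Definition smooth_point (R : realType) (X : normedModType R) (x : X) : Prop :=
  unit_sphere X x /\ exists! f : X -> R^o, dual_unit_sphere X f /\ f x = 1.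

Definition admits_smooth_point (R : realType) (X : normedModType R) : Prop :=
  forall C : set X, maximal_convex_of_sphere C ->
    exists2 x, C x & smooth_point x.

Definition separable_space (T : topologicalType) : Prop :=
  exists2 D : set T, countable D & dense D.

(* A map between the spheres is represented by a total map [T : X -> Y], whose
   values off the sphere of [X] are irrelevant. *)
Definition Mazur_Ulam_property (R : realType) (X : completeNormedModType R) :
    Prop :=
  forall (Y : completeNormedModType R) (T : X -> Y),
    T @` unit_sphere X = unit_sphere Y ->
    (forall x y, unit_sphere X x -> unit_sphere X y ->
      `|T x - T y| = `|x - y|) ->
    exists U : {linear X -> Y},
      [/\ forall x, `|U x| = `|x|, range U = setT
        & forall x, unit_sphere X x -> T x = U x].

(* Main.v *)
From HB Require Import structures.
Require Import Defs.
From mathcomp Require Import all_boot all_order all_algebra.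
From mathcomp Require Import all_classical all_reals all_analysis.
From mathcomp Require Import ring lra.

Set Implicit Arguments.
Unset Strict Implicit.
Unset Printing Implicit Defensive.

Import Order.TTheory GRing.Theory Num.Theory.
Import numFieldNormedType.Exports.

Local Open Scope classical_set_scope.
Local Open Scope ring_scope.

(** Let T be a surjective isometry between the unit spheres of X and Y, and C
    a maximal convex subset of the sphere of X, supported by a norm-one
    functional f, so that f = 1 on C.

    In an almost-CL-space every unit vector z is a limit of vectors
    a *: c - b *: d with c, d in C and a + b = 1, and such a vector u
    satisfies f u = a - b, is within 2b = 1 - f u of c and within
    2a = 1 + f u of - d. Thus the distances from z to C and to -C are 1 - f z
    and 1 + f z: the functional f can be read off the metric of the sphere.
    Suppose that both T(C) and -T(-C) lie in one convex subset D of the sphere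
    of Y, and let g support D. Then g is 1 on T(C) and -1 on T(-C), and the
    two distances, which T preserves, force g (T z) = f z on the whole sphere
    ([isom_functional]). The functionals g obtained from all C separate the
    points of Y, because every unit vector of Y is T p with p in some C. Hence
    the positively homogeneous extension of T, being linear after composition
    with every g, is linear ([isom_linear_extension]).

    The set D comes from a smooth point x of C ([isom_face]). Smoothness means
    that the unit vectors y with `|x + y| = 2 are exactly those of C
    ([smooth_star]). Choose D maximal convex and containing both T x and
    - T (- x), which is possible since their sum has norm `|x - - x| = 2.
    Comparing an element of D with these two points and pulling back by T
    shows that it belongs to T(C) and to -T(-C); its distances to the rest of
    these sets are then known, and maximality puts all of them in D.

    In a separable space, let (c n) be dense in C and x the sum of the
    2^-(n+1) *: c n. A contractive functional equal to 1 at x is 1 at each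
    c n, hence on C, hence determined everywhere as the ball is the closed
    convex hull of C and -C: so x is a smooth point of C
    ([separable_admits_smooth_point]).

    Functionals come from a form of the Hahn-Banach theorem
    ([hahn_banach_cone]) whose proof rests on the fact that the minimal
    sublinear functionals are the linear ones. *)

(** * The Hahn-Banach theorem through minimal sublinear functionals *)

Definition sublinear (R : realType) (X : lmodType R) (p : X -> R) :=
  (forall x y, p (x + y) <= p x + p y) /\
  (forall t x, 0 <= t -> p (t *: x) <= t * p x).

Section Sublinear.
Variables (R : realType) (X : lmodType R).
Implicit Types (p q : X -> R) (x y : X) (K : set (X * R)).

Lemma sublinear0 p : sublinear p -> p 0 = 0.
Proof.
move=> [pD pZ]; apply/eqP; rewrite eq_le.
have := pD 0 0; have := pZ 0 0 (lexx _).
by rewrite scaler0 addr0; lra.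
Qed.

Lemma sublinear_oppr p x : sublinear p -> - p (- x) <= p x.
Proof.
move=> sp; have := sp.1 x (- x); rewrite subrr sublinear0//; lra.
Qed.

Lemma sublinear_odd p : sublinear p -> (forall x, p (- x) <= - p x) ->
  linear (p : X -> R^o).
Proof.
move=> sp podd.
have pN x : p (- x) = - p x.
  by apply/eqP; rewrite eq_le podd /=; have := sublinear_oppr x sp; lra.
have pD x y : p (x + y) = p x + p y.
  apply/eqP; rewrite eq_le sp.1 /=.
  have := sp.1 (x + y) (- y); rewrite addrK pN; lra.
have pZ t x : 0 <= t -> p (t *: x) = t * p x.
  move=> t0; apply/eqP; rewrite eq_le sp.2//=.
  have := sp.2 t (- x) t0; rewrite scalerN !pN; lra.
move=> a u v; rewrite pD; congr (_ + _).
have [a0|a0] := leP 0 a; first exact: pZ.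
by rewrite -[a]opprK scaleNr pN pZ ?oppr_ge0 ?ltW// -mulNr.
Qed.

(** The index k may depend on the points x and y. This serves both the infimum
    over a chain, where k is the smaller of the two functionals, and the
    infimum of translates in [sublinear_cone], where it is a sum of cone
    elements. *)
Lemma sublinear_inf (I : Type) (D : set I) (q : I -> X -> R) :
  D !=set0 ->
  (forall x, has_lbound [set q i x | i in D]) ->
  (forall i j x y, D i -> D j ->
     exists2 k, D k & q k (x + y) <= q i x + q j y) ->
  (forall i t x, D i -> 0 <= t -> exists2 k, D k & q k (t *: x) <= t * q i x) ->
  sublinear (fun x => inf [set q i x | i in D]).
Proof.
move=> [i0 Di0] lb qD qZ.
have ne x : [set q i x | i in D] !=set0 by exists (q i0 x), i0.
have infE x k : D k -> inf [set q i x | i in D] <= q k x.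
  by move=> Dk; apply: ge_inf => //; exists k.
split=> [x y|t x t0].
  rewrite /= -lerBlDr; apply: lb_le_inf => // _ [i Di <-].
  rewrite lerBlDr -lerBlDl; apply: lb_le_inf => // _ [j Dj <-].
  rewrite lerBlDl.
  by have [k Dk] := qD i j x y Di Dj; apply: le_trans; exact: infE.
move=> /=; have [->|tn0] := eqVneq t 0.
  have [k Dk] := qZ i0 0 x Di0 (lexx _).
  by rewrite !mul0r; apply: le_trans; exact: infE.
have tp : 0 < t by rewrite lt_neqAle eq_sym tn0.
rewrite /= -ler_pdivrMl//; apply: lb_le_inf => // _ [i Di <-].
rewrite ler_pdivrMl//.
by have [k Dk] := qZ i t x Di t0; apply: le_trans; exact: infE.
Qed.

(** The functional is p x = inf (q (x + k.1) - k.2) over k in K, finite because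
    q (x + k.1) >= q k.1 - q (- x) >= k.2 - q (- x). An element k of K
    prescribes the lower bound k.2 at k.1 for the linear functionals below
    p. *)
Lemma sublinear_cone q K : sublinear q -> K (0, 0) ->
  (forall k l, K k -> K l -> K (k + l)) ->
  (forall t k, 0 <= t -> K k -> K (t *: k.1, t * k.2)) ->
  (forall k, K k -> k.2 <= q k.1) ->
  exists2 p, sublinear p &
    (forall x, p x <= q x) /\ (forall k, K k -> p (- k.1) <= - k.2).
Proof.
move=> sq K0 KD KZ Kq.
have lb x : has_lbound [set q (x + k.1) - k.2 | k in K].
  exists (- q (- x)) => _ [k Kk <-].
  have := sq.1 (x + k.1) (- x); rewrite addrAC subrr add0r.
  by have := Kq _ Kk; lra.
exists (fun x => inf [set q (x + k.1) - k.2 | k in K]).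
  apply: (sublinear_inf (q := fun k x => q (x + k.1) - k.2)) => //.
  - by exists (0, 0).
  - move=> k l x y Kk Kl; exists (k + l); first exact: KD.
    rewrite /= addrACA; have := sq.1 (x + k.1) (y + l.1); lra.
  - move=> k t x Kk t0; exists (t *: k.1, t * k.2); first exact: KZ.
    by rewrite /= -scalerDr; have := sq.2 t (x + k.1) t0; lra.
split=> [x|k Kk].
  by apply: ge_inf => //; exists (0, 0) => //=; rewrite addr0 subr0.
apply: ge_inf => //; exists k => //.
by rewrite addNr sublinear0// sub0r.
Qed.

(** Zorn's lemma applies since every sublinear p below q satisfies
    p x >= - q (- x), so that infima of chains stay finite. *)
Lemma sublinear_minimal q : sublinear q ->
  exists2 p, sublinear p & (forall x, p x <= q x) /\
    forall p', sublinear p' -> (forall x, p' x <= p x) -> p' = p.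
Proof.
move=> sq.
pose P := {p : X -> R | sublinear p /\ forall x, p x <= q x}.
pose le (p p' : P) := `[< forall x, sval p' x <= sval p x >].
have [||||[p [sp pq]] pmin] := @Zorn P le.
- by move=> p; apply/asboolP.
- move=> p1 p2 p3 /asboolP h1 /asboolP h2; apply/asboolP => x.
  exact: le_trans (h2 x) (h1 x).
- move=> [p1 h1] [p2 h2] /asboolP /= h12 /asboolP /= h21.
  by apply/eq_exist/funext => x; apply/eqP; rewrite eq_le h12 h21.
- move=> A totA.
  have [[p0 Ap0]|/set0P/negP/negPn/eqP A0] := pselect (A !=set0); last first.
    by exists (exist _ q (conj sq (fun x => lexx _))) => s; rewrite A0.
  have lb x : has_lbound [set sval p x | p in A].
    exists (- q (- x)) => _ [p Ap <-].
    have [sp pq] := svalP p; have := sublinear_oppr x sp.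
    by have := pq (- x); lra.
  have sinf : sublinear (fun x => inf [set sval p x | p in A]).
    apply: (sublinear_inf (q := fun p : P => sval p)) => //.
    + by exists p0.
    + move=> p1 p2 x y A1 A2.
      have [s1 _] := svalP p1; have [s2 _] := svalP p2.
      have [/asboolP le12|/asboolP le21] := totA _ _ A1 A2.
        by exists p2 => //; have := s2.1 x y; have := le12 x; lra.
      by exists p1 => //; have := s1.1 x y; have := le21 y; lra.
    + move=> p t x Ap t0; have [s _] := svalP p.
      by exists p => //; exact: s.2.
  have infq x : inf [set sval p x | p in A] <= q x.
    have [_ /(_ x)] := svalP p0; apply: le_trans.
    by apply: ge_inf => //; exists p0.
  exists (exist (fun p => sublinear p /\ forall x, p x <= q x) _ (conj sinf infq)).
  move=> p Ap; apply/asboolP => x /=.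
  by apply: ge_inf => //; exists p.
exists p => //; split=> // p' sp' p'p.
have p'q x : p' x <= q x by exact: le_trans (p'p x) (pq x).
have /pmin[//] : le (exist _ p (conj sp pq))
    (exist (fun p => sublinear p /\ forall x, p x <= q x) p' (conj sp' p'q)).
exact/asboolP.
Qed.

(** A minimal sublinear p is odd, hence linear: pushing p down along the ray
    through (y, p y) by [sublinear_cone] cannot change it, yet makes its value
    at - y at most - p y. *)
Lemma hahn_banach_cone q K : sublinear q -> K (0, 0) ->
  (forall k l, K k -> K l -> K (k + l)) ->
  (forall t k, 0 <= t -> K k -> K (t *: k.1, t * k.2)) ->
  (forall k, K k -> k.2 <= q k.1) ->
  exists f : {linear X -> R^o},
    (forall x, f x <= q x) /\ (forall k, K k -> k.2 <= f k.1).
Proof.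
move=> sq K0 KD KZ Kq.
have [r sr [rq rK]] := sublinear_cone sq K0 KD KZ Kq.
have [p sp [pr pmin]] := sublinear_minimal sr.
have podd y : p (- y) <= - p y.
  pose Ky : set (X * R) := [set k | exists2 t, 0 <= t & k = (t *: y, t * p y)].
  have [|||| p' sp' [p'p p'y]] := @sublinear_cone p Ky sp.
  - by exists 0 => //; rewrite scale0r mul0r.
  - move=> _ _ [s s0 ->] [t t0 ->]; exists (s + t); first exact: addr_ge0.
    by rewrite scalerDl mulrDl.
  - move=> t _ t0 [s s0 ->]; exists (t * s); first exact: mulr_ge0.
    by rewrite scalerA mulrA.
  - move=> _ [t t0 ->] /=.
    have [->|tn0] := eqVneq t 0; first by rewrite mul0r scale0r sublinear0.
    have tp : 0 < t by rewrite lt_neqAle eq_sym tn0.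
    have := sp.2 t^-1 (t *: y); rewrite invr_ge0 scalerA mulVf// scale1r.
    by move=> /(_ t0); rewrite ler_pdivlMl.
  have := p'y (y, p y); rewrite (pmin _ sp' p'p) /=; apply.
  by exists 1 => //; rewrite scale1r mul1r.
pose f : {linear X -> R^o} :=
  HB.pack (p : X -> R^o) (GRing.isLinear.Build _ _ _ _ _ (sublinear_odd sp podd)).
exists f; split=> [x|k Kk]; first exact: le_trans (pr x) (rq x).
have := le_trans (pr _) (rK k Kk).
rewrite -[p]/(f : X -> R) linearN; rewrite lerN2; exact.
Qed.

End Sublinear.

(** * Maximal convex subsets of the sphere *)

Section Faces.
Variables (R : realType) (X : normedModType R).
Implicit Types (x y : X) (A C D : set X).

(** The weights are plain real numbers here, which spares the conversions to
    the interval type used by [convex_set]. *)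
Lemma convex_setP A : @convex_set R X A <->
  forall x y (a b : R), A x -> A y -> 0 <= a -> 0 <= b -> a + b = 1 ->
    A (a *: x + b *: y).
Proof.
split=> [cA x y a b Ax Ay a0 b0 ab1|cA x y l].
  have a1 : a <= 1 by lra.
  have := cA x y (Itv01 a0 a1); rewrite !inE => /(_ Ax Ay).
  by have -> : b = 1 - a by lra.
rewrite !inE => Ax Ay; apply: cA => //=; last exact: subrKC.
by rewrite subr_ge0.
Qed.

(** The cone generated by a convex set is closed under addition; when both
    weights vanish any point of the set will do. *)
Lemma convex_cone A x y (a b : R) : @convex_set R X A -> A x -> A y ->
  0 <= a -> 0 <= b -> exists2 z, A z & a *: x + b *: y = (a + b) *: z.
Proof.
move=> /convex_setP cA Ax Ay a0 b0.
have [ab0|abn0] := eqVneq (a + b) 0.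
  have -> : a = 0 by lra.
  have -> : b = 0 by lra.
  by exists x => //; rewrite !scale0r !addr0 scale0r.
have ab0 : 0 <= a + b by exact: addr_ge0.
exists (a / (a + b) *: x + b / (a + b) *: y).
  by apply: cA; rewrite ?divr_ge0// -mulrDl divff.
by rewrite scalerDr !scalerA !(mulrC (a + b)) !divfK.
Qed.

Definition segment x y : set X :=
  [set z | exists a b : R, [/\ 0 <= a, 0 <= b, a + b = 1 & z = a *: x + b *: y]].

Lemma segment_left x y : segment x y x.
Proof. by exists 1, 0; rewrite scale1r scale0r !addr0. Qed.

Lemma segment_right x y : segment x y y.
Proof. by exists 0, 1; rewrite scale1r scale0r !add0r. Qed.

Lemma convex_segment x y : @convex_set R X (segment x y).
Proof.
apply/convex_setP => _ _ s t [a [b [a0 b0 ab ->]]] [c [d [c0 d0 cd ->]]] s0 t0 st.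
exists (s * a + t * c), (s * b + t * d).
split; [exact: addr_ge0 (mulr_ge0 _ _) (mulr_ge0 _ _) |
  exact: addr_ge0 (mulr_ge0 _ _) (mulr_ge0 _ _) | | ].
  by rewrite addrACA -!mulrDr ab cd !mulr1.
by rewrite !scalerDr !scalerA addrACA -!scalerDl.
Qed.

(** The mirror images a *: x + b *: y and b *: x + a *: y add up to x + y, of
    norm 2, while neither has norm above 1. *)
Lemma segment_sphere x y : `|x| = 1 -> `|y| = 1 -> `|x + y| = 2 ->
  segment x y `<=` unit_sphere X.
Proof.
move=> x1 y1 xy2 _ [a [b [a0 b0 ab1 ->]]]; rewrite /unit_sphere /=.
have le1 (c d : R) : 0 <= c -> 0 <= d -> c + d = 1 -> `|c *: x + d *: y| <= 1.
  move=> c0 d0 cd; apply: le_trans (ler_normD _ _) _.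
  by rewrite !normrZ x1 y1 !mulr1 !ger0_norm// cd.
have /(le1 _ _ b0 a0) h2 : b + a = 1 by rewrite addrC.
have h1 := le1 _ _ a0 b0 ab1.
have := ler_normD (a *: x + b *: y) (b *: x + a *: y).
rewrite addrACA -!scalerDl (addrC b) ab1 !scale1r xy2 => h.
by apply/eqP; rewrite eq_le h1 /=; lra.
Qed.

Lemma sphere_convex_add A x y : A `<=` unit_sphere X -> @convex_set R X A ->
  A x -> A y -> `|x + y| = 2.
Proof.
move=> AS /convex_setP cA Ax Ay.
have h : 0 <= 2^-1 :> R by rewrite invr_ge0.
have := cA x y 2^-1 2^-1 Ax Ay h h; rewrite -scalerDr => /(_ _)/AS -/(_ _) H.
have {H} : `|2^-1 *: (x + y)| = 1 by apply: H; lra.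
rewrite normrZ ger0_norm// => /(congr1 (fun r => 2 * r)).
by rewrite mulrA mulfV// mul1r mulr1.
Qed.

(** Hahn-Banach for the cone of the pairs (t *: a, t) with a in A, on which the
    norm of the first component is exactly the second one. *)
Lemma supporting_functional A : A !=set0 -> A `<=` unit_sphere X ->
  @convex_set R X A -> exists f : {linear X -> R^o},
    (forall x, f x <= `|x|) /\ (forall x, A x -> f x = 1).
Proof.
move=> [a0 Aa0] AS cA.
pose K : set (X * R) :=
  [set k | exists (t : R) a, [/\ 0 <= t, A a & k = (t *: a, t)]].
have snorm : sublinear (fun x : X => `|x|).
  by split=> [x y|t x t0]; [exact: ler_normD | rewrite normrZ ger0_norm].
have [||||f [fle fK]] := @hahn_banach_cone _ _ _ K snorm.
- by exists 0, a0; rewrite scale0r.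
- move=> _ _ [s [a [s0 Aa ->]]] [t [b [t0 Ab ->]]].
  have [c Ac E] := convex_cone cA Aa Ab s0 t0.
  exists (s + t), c; split; [exact: addr_ge0| by []|].
  by rewrite -E.
- move=> t _ t0 [s [a [s0 Aa ->]]]; exists (t * s), a.
  by rewrite mulr_ge0//= scalerA.
- by move=> _ [t [a [t0 /AS a1 ->]]] /=; rewrite normrZ a1 mulr1 ger0_norm.
exists f; split=> // x Ax; apply/eqP; rewrite eq_le.
have := fle x; rewrite (AS _ Ax : `|x| = 1) => -> /=.
have := fK (x, 1); apply.
by exists 1, x; rewrite scale1r.
Qed.

(** Zorn's lemma is applied to the sets whose union with A is convex and lies in
    the sphere, so that the union of an empty chain raises no difficulty. *)
Lemma exists_maximal_convex A : A `<=` unit_sphere X -> @convex_set R X A ->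
  exists2 C, maximal_convex_of_sphere C & A `<=` C.
Proof.
move=> AS cA.
pose P D := D `|` A `<=` unit_sphere X /\ @convex_set R X (D `|` A).
have [|F [[FS cF] Fmax]] := @Zorn_bigcup _ P.
  move=> G GP totG; split=> [x [[D GD Dx]|/AS//]|].
    by have [+ _] := GP _ GD; apply; left.
  apply/convex_setP => x y a b xG yG a0 b0 ab.
  have conv D : G D -> (D `|` A) x -> (D `|` A) y ->
      (\bigcup_(D in G) D `|` A) (a *: x + b *: y).
    move=> GD Dx Dy; have [_ /convex_setP cD] := GP _ GD.
    have [] := cD _ _ _ _ Dx Dy a0 b0 ab; last by right.
    by left; exists D.
  case: xG => [[D1 G1 D1x]|Ax]; case: yG => [[D2 G2 D2y]|Ay].
  - have [sub|sub] := totG _ _ G1 G2.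
      by apply: (conv D2) => //; left=> //; exact: sub.
    by apply: (conv D1) => //; left=> //; exact: sub.
  - by apply: (conv D1) => //; [left|right].
  - by apply: (conv D2) => //; [right|left].
  - by right; move/convex_setP: cA; apply.
exists (F `|` A); last by right.
split=> // D DS cD [FAD DFA].
have AD : A `<=` D by move=> x Ax; apply: FAD; right.
apply: (Fmax D); last by rewrite /P setUidl.
split; first by move=> x Fx; apply: FAD; left.
by move=> DF; apply: DFA => x /DF; left.
Qed.

(** Otherwise the union of the segments from y to the points of C would be a
    larger convex subset of the sphere. *)
Lemma maximal_convex_star C y : maximal_convex_of_sphere C -> C !=set0 ->
  unit_sphere X y -> (forall x, C x -> `|x + y| = 2) -> C y.
Proof.
move=> [CS cC Cmax] [c0 Cc0] y1 Cy.
pose D := \bigcup_(x in C) segment x y.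
have CD : C `<=` D by move=> x Cx; exists x => //; exact: segment_left.
have Dy : D y by exists c0 => //; exact: segment_right.
apply: contrapT => nCy; apply: (Cmax D); last by split=> // /(_ y Dy).
  by move=> z [x Cx]; apply: segment_sphere => //; [exact: CS|exact: Cy].
apply/convex_setP => _ _ s t [x Cx [a [b [a0 b0 ab ->]]]]
  [x' Cx' [a' [b' [a'0 b'0 a'b' ->]]]] s0 t0 st.
have [z Cz E] := convex_cone cC Cx Cx' (mulr_ge0 s0 a0) (mulr_ge0 t0 a'0).
exists z => //; exists (s * a + t * a'), (s * b + t * b').
split; [exact: addr_ge0 (mulr_ge0 _ _) (mulr_ge0 _ _) |
  exact: addr_ge0 (mulr_ge0 _ _) (mulr_ge0 _ _) | | ].
  by rewrite addrACA -!mulrDr ab a'b' !mulr1.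
by rewrite !scalerDr !scalerA addrACA E -scalerDl.
Qed.

Lemma sphereN x : unit_sphere X x -> unit_sphere X (- x).
Proof. by rewrite /unit_sphere /= normrN. Qed.

Lemma norm_normalize x : x != 0 -> `| `|x|^-1 *: x| = 1.
Proof.
by move=> x0; rewrite normrZ normfV normr_id mulVf// normr_eq0.
Qed.

Lemma contractive_abs (f : {linear X -> R^o}) :
  (forall y, f y <= `|y|) -> forall y, `|f y| <= `|y|.
Proof.
by move=> fle y; rewrite ler_norml fle andbT lerNl -linearN -(normrN y).
Qed.

Lemma contractive_continuous (f : {linear X -> R^o}) :
  (forall y, f y <= `|y|) -> continuous f.
Proof.
move=> /contractive_abs fabs.
apply/linear_bounded_continuous/linear_boundedP.
near=> r => y; apply: le_trans (fabs y) _.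
by rewrite ler_peMl//; near: r; exact: nbhs_pinfty_ge.
Unshelve. all: by end_near. Qed.

(** This and the next lemma translate the dual unit sphere into functionals
    below the norm, the form in which Hahn-Banach provides and uses them. *)
Lemma contractive_dual_unit_sphere (f : {linear X -> R^o}) x :
  (forall y, f y <= `|y|) -> unit_sphere X x -> f x = 1 ->
  dual_unit_sphere X f.
Proof.
move=> fle x1 fx1.
have fabs := contractive_abs fle.
split; [exact: linearP|exact: contractive_continuous|].
apply/eqP; rewrite eq_le; apply/andP; split.
  apply: ge_sup; first by exists `|f 0|, 0 => //; rewrite /unit_ball /= normr0.
  by move=> _ [y y1 <-]; exact: le_trans (fabs y) y1.
apply: ub_le_sup; last by exists x; rewrite ?fx1 ?normr1// /unit_ball /= x1.
by exists 1 => _ [y y1 <-]; exact: le_trans (fabs y) y1.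
Qed.

Lemma dual_unit_sphere_contractive (f : X -> R^o) : dual_unit_sphere X f ->
  exists2 g : {linear X -> R^o}, f = g & forall x, g x <= `|x|.
Proof.
move=> [lf cf f1].
pose g : {linear X -> R^o} := HB.pack f (GRing.isLinear.Build _ _ _ _ _ lf).
exists g => // x.
have [->|x0] := eqVneq x 0; first by rewrite linear0 normr0.
have nx0 : 0 < `|x| by rewrite normr_gt0.
have ub : has_ubound [set `|f y| | y in unit_ball X].
  have /linear_bounded_continuous/linear_boundedP/pinfty_ex_gt0 [M M0 gM] :
    continuous g by [].
  exists M => _ [y y1 <-]; apply: le_trans (gM y) _.
  by rewrite ler_piMr// ltW.
have : `|g (`|x|^-1 *: x)| <= 1.
  rewrite -f1; apply: ub_le_sup => //; exists (`|x|^-1 *: x) => //.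
  by rewrite /unit_ball /= norm_normalize.
rewrite linearZ /= => /(le_trans (ler_norm _)).
by rewrite -[_ *: _]/(_ * _) ler_pdivrMl// mulr1.
Qed.

(** The segment from x to y lies in the sphere, so it has a supporting
    functional; by smoothness at x it coincides with the one supporting C, and
    the sum of y and any point of C then has norm 2. *)
Lemma smooth_star C x y : maximal_convex_of_sphere C -> C x ->
  smooth_point x -> unit_sphere X y -> `|x + y| = 2 -> C y.
Proof.
move=> mC Cx [x1 [f0 [_ f0uniq]]] y1 xy2.
have [CS cC _] := mC.
have [|f [fle fC]] := supporting_functional _ CS cC; first by exists x.
have [|h [hle hxy]] := supporting_functional _ (segment_sphere x1 y1 xy2)
  (@convex_segment x y); first by exists x; exact: segment_left.
have hx : h x = 1 by apply: hxy; exact: segment_left.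
have fh : f = h :> (X -> R^o).
  rewrite -(f0uniq f); last first.
    by split; [exact: (contractive_dual_unit_sphere fle x1 (fC _ Cx))|exact: fC].
  apply: f0uniq; split=> //; exact: (contractive_dual_unit_sphere hle x1 hx).
apply: maximal_convex_star => // [|z Cz]; first by exists x.
apply/eqP; rewrite eq_le; apply/andP; split.
  by apply: le_trans (ler_normD _ _) _; rewrite (CS _ Cz : `|z| = 1) y1.
apply: le_trans (hle _); rewrite linearD -fh fC// fh hxy//.
exact: segment_right.
Qed.

Lemma almost_CL_nonempty C : almost_CL_space X -> maximal_convex_of_sphere C ->
  C !=set0.
Proof.
move=> aX mC; apply/set0P/negP => /eqP C0.
have := aX _ mC; rewrite C0 image_set0 setU0 /convex_hull.
rewrite smallest_id; last by apply/convex_setP.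
rewrite closure0 => /seteqP[/(_ 0) + _]; apply.
by rewrite /unit_ball /= normr0.
Qed.

(** The vectors a *: c - b *: d already form a convex set containing C and -C,
    so no longer combinations are needed. *)
Lemma almost_CL_approx C x (e : R) : almost_CL_space X ->
  maximal_convex_of_sphere C -> `|x| <= 1 -> 0 < e ->
  exists c d (a b : R), [/\ C c /\ C d, 0 <= a /\ 0 <= b, a + b = 1 &
    `|x - (a *: c - b *: d)| < e].
Proof.
move=> aX mC x1 e0; have [c0 Cc0] := almost_CL_nonempty aX mC.
have [_ cC _] := mC.
pose M : set X := [set z | exists c d a b,
  [/\ C c /\ C d, 0 <= a /\ 0 <= b, a + b = 1 & z = a *: c - b *: d]].
have hullM : convex_hull (C `|` (-%R @` C)) `<=` M.
  apply: smallest_sub.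
    apply/convex_setP => _ _ s t
      [c [d [a [b [[Cc Cd] [a0 b0] ab ->]]]]]
      [c' [d' [a' [b' [[Cc' Cd'] [a'0 b'0] ab' ->]]]]] s0 t0 st.
    have [c2 Cc2 Ec] := convex_cone cC Cc Cc' (mulr_ge0 s0 a0) (mulr_ge0 t0 a'0).
    have [d2 Cd2 Ed] := convex_cone cC Cd Cd' (mulr_ge0 s0 b0) (mulr_ge0 t0 b'0).
    exists c2, d2, (s * a + t * a'), (s * b + t * b'); split=> //.
    - by rewrite !addr_ge0 ?mulr_ge0.
    - by rewrite addrACA -!mulrDr ab ab' !mulr1.
    - by rewrite !scalerBr !scalerA addrACA Ec -Ed opprD.
  move=> z [Cz|[d Cd <-]].
    by exists z, z, 1, 0; rewrite scale1r scale0r subr0 addr0.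
  by exists d, d, 0, 1; rewrite scale1r scale0r sub0r add0r.
have : closure (convex_hull (C `|` (-%R @` C))) x by rewrite -aX.
move=> /(_ (ball x e)) [|z [/hullM [c [d [a [b [h1 h2 h3 ->]]]]]]].
  exact: nbhsx_ballx.
rewrite -ball_normE /= => h; by exists c, d, a, b.
Qed.

End Faces.

(** * Isometries between unit spheres *)

Section Isometry.
Variables (R : realType) (X Y : normedModType R) (T : X -> Y).
Hypothesis T_onto : T @` unit_sphere X = unit_sphere Y.
Hypothesis T_isom : forall x y, unit_sphere X x -> unit_sphere X y ->
  `|T x - T y| = `|x - y|.
Implicit Types (x z : X) (C : set X).

Lemma isom_sphere x : unit_sphere X x -> unit_sphere Y (T x).
Proof. by move=> x1; rewrite -T_onto; exists x. Qed.

(** A metric characterization does the work: a vector of the sphere of Y lies in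
    D as soon as its sum with every v in D has norm 2. If v is in D, then
    - v = T w where - w is in C, since v and T x both lie in D and
    `|T x - T w| = `|x - w|; this controls `|v + T c| = `|T c - T w|. The same
    with v = T w and - T (- x) controls v - T (- c). *)
Lemma isom_face C x : maximal_convex_of_sphere C -> C x -> smooth_point x ->
  exists D : set Y, [/\ D `<=` unit_sphere Y, @convex_set R Y D,
    forall c, C c -> D (T c) & forall c, C c -> D (- T (- c))].
Proof.
move=> mC Cx sx; have [CS cC _] := mC.
have x1 := CS _ Cx; have xN1 := sphereN x1.
have Tx1 := isom_sphere x1; have TNx1 := sphereN (isom_sphere xN1).
have TxN : `|T x + - T (- x)| = 2.
  by rewrite T_isom// opprK (sphere_convex_add CS).
have [D mD xD] := exists_maximal_convex (segment_sphere Tx1 TNx1 TxN)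
  (@convex_segment _ _ _ _).
have DTx := xD _ (segment_left _ _); have DTNx := xD _ (segment_right _ _).
have [DS cD _] := mD.
have D0 : D !=set0 by exists (T x).
exists D; split=> // c Cc; have c1 := CS _ Cc.
- apply: maximal_convex_star => // [|v Dv]; first exact: isom_sphere.
  have := sphereN (DS _ Dv); rewrite -T_onto => -[w w1 vE].
  have Cw : C (- w).
    apply: (smooth_star mC Cx sx) (sphereN w1) _.
    rewrite -T_isom// vE opprK.
    exact: (sphere_convex_add DS).
  rewrite -[v]opprK -vE addrC T_isom//.
  exact: (sphere_convex_add CS).
- apply: maximal_convex_star => // [|v Dv].
    exact/sphereN/isom_sphere/sphereN.
  have := DS _ Dv; rewrite -T_onto => -[w w1 vE].
  have Cw : C w.
    apply: (smooth_star mC Cx sx) => //.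
    rewrite -normrN opprD -T_isom// vE -normrN opprB.
    exact: (sphere_convex_add DS).
  rewrite -vE T_isom//; last exact: sphereN.
  by rewrite opprK; exact: (sphere_convex_add CS).
Qed.

(** Let z be approximated by a *: c - b *: d within e. Then z is within
    2 * b + e of c, so T z is as close to T c, where g is 1: this bounds g (T z)
    from below. The distance from z to - d bounds it from above, as g is -1 at
    T (- d). Both bounds tend to f z as e tends to 0. *)
Lemma isom_functional C x : almost_CL_space X ->
  maximal_convex_of_sphere C -> C x -> smooth_point x ->
  exists (f : {linear X -> R^o}) (g : {linear Y -> R^o}),
    (forall c, C c -> f c = 1) /\ (forall z, unit_sphere X z -> g (T z) = f z).
Proof.
move=> aX mC Cx sx; have [CS cC _] := mC.
have [|f [fle fC]] := supporting_functional _ CS cC; first by exists x.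
have [D [DS cD DT DTN]] := isom_face mC Cx sx.
have [|g [gle gD]] := supporting_functional _ DS cD.
  by exists (T x); exact: DT.
exists f, g; split=> // z z1.
have key (e : R) : 0 < e -> f z - 2 * e <= g (T z) <= f z + 2 * e.
  move=> e0; have z1' : `|z| <= 1 by rewrite (z1 : `|z| = 1).
  have [c [d [a [b [[Cc Cd] [a0 b0] ab zu]]]]] := almost_CL_approx aX mC z1' e0.
  have c1 := CS _ Cc; have d1 := CS _ Cd.
  set u := a *: c - b *: d in zu.
  have fu : f u = a - b.
    rewrite linearB !linearZ /= !fC// scalerN.
    by congr (_ - _); exact: mulr1.
  have /ler_normlP[fzu1 fzu2] : `|f z - f u| <= `|z - u|.
    by rewrite -linearB; exact: contractive_abs.
  have cd2 : `|c + d| = 2 by exact: (sphere_convex_add CS).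
  have zc : `|c - z| <= 2 * b + e.
    apply: le_trans (ler_distD u _ _) _; apply: lerD; last first.
      by rewrite distrC ltW.
    (* Here c is split as a *: c + b *: c. *)
    have -> : c - u = b *: (c + d).
      rewrite -{1}[c]scale1r -ab scalerDl scalerDr opprB.
      by rewrite [a *: c + _]addrC addrACA subrr addr0.
    by rewrite normrZ cd2 ger0_norm// mulrC.
  have zd : `|z - - d| <= e + 2 * a.
    apply: le_trans (ler_distD u _ _) _; apply: lerD; first exact: ltW.
    have -> : u - - d = a *: (c + d).
      rewrite /u opprK -{2}[d]scale1r -ab scalerDl scalerDr.
      by rewrite addrACA addNr addr0.
    by rewrite normrZ cd2 ger0_norm// mulrC.
  have gc : g (T c) = 1 by exact/gD/DT.
  have gd : g (T (- d)) = - 1.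
    by have := gD _ (DTN _ Cd); rewrite linearN => <-; rewrite opprK.
  have := gle (T c - T z); rewrite linearB/= gc T_isom//.
  have := gle (T z - T (- d)); rewrite linearB/= gd T_isom//; last exact: sphereN.
  lra.
apply/eqP; rewrite eq_le; apply/andP; split; apply/ler_addgt0Pr => e e0.
all: have e2 : 0 < e / 2 by lra.
all: by have /andP[] := key _ e2; lra.
Qed.

(** The extension V z = `|z| *: T (z / `|z|) satisfies g (V z) = f z for each of
    the pairs (f, g) above. A defect y of linearity of V is killed by all the
    g, but if y were nonzero, its direction would be T p with p in some maximal
    convex set, whose g is positive at y. *)
Lemma isom_linear_extension : almost_CL_space X -> admits_smooth_point X ->
  exists U : {linear X -> Y}, [/\ forall x, `|U x| = `|x|, range U = setT
    & forall x, unit_sphere X x -> T x = U x].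
Proof.
move=> aX sX.
have Tnorm z : `|z| = 1 -> `|T z| = 1 by exact: isom_sphere.
pose V z := `|z| *: T (`|z|^-1 *: z).
have Vsphere z : `|z| = 1 -> V z = T z.
  by move=> z1; rewrite /V z1 invr1 !scale1r.
have Vnorm z : `|V z| = `|z|.
  rewrite /V normrZ normr_id; have [->|z0] := eqVneq z 0.
    by rewrite normr0 mul0r.
  by rewrite Tnorm ?mulr1// norm_normalize.
have Vonto y : exists x, V x = y.
  have [->|y0] := eqVneq y 0; first by exists 0; rewrite /V normr0 scale0r.
  have : unit_sphere Y (`|y|^-1 *: y) by exact: norm_normalize.
  rewrite -T_onto => -[x x1 Tx]; exists (`|y| *: x).
  have nx : `| `|y| *: x| = `|y| by rewrite normrZ normr_id x1 mulr1.
  by rewrite /V nx scalerA mulVf ?normr_eq0// scale1r Tx scalerA mulfV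
    ?normr_eq0// scale1r.
have separate y : y != 0 -> exists (f : {linear X -> R^o}) (g : {linear Y -> R^o}),
    (forall z, g (V z) = f z) /\ g y != 0.
  move=> y0; have : unit_sphere Y (`|y|^-1 *: y) by exact: norm_normalize.
  rewrite -T_onto => -[p p1 Tp].
  (* The degenerate segment at p is a convex subset of the sphere. *)
  have pp : `|p + p| = 2 by rewrite -mulr2n normrMn p1.
  have [C mC pC] := exists_maximal_convex (segment_sphere p1 p1 pp)
    (@convex_segment _ _ _ _).
  have [x Cx sx] := sX _ mC.
  have [f [g [fC gT]]] := isom_functional aX mC Cx sx.
  exists f, g; split=> [z|].
    have [->|z0] := eqVneq z 0; first by rewrite /V normr0 scale0r !linear0.
    rewrite /V linearZ /= gT; last exact: norm_normalize.
    by rewrite linearZ /= scalerA mulfV ?normr_eq0// scale1r.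
  apply: contraTneq isT => gy.
  have := gT _ p1; rewrite Tp linearZ /= gy scaler0 fC; last first.
    exact/pC/segment_left.
  by move=> /esym/eqP; rewrite oner_eq0.
have Vlin : linear V.
  move=> a z w; apply/eqP; rewrite -subr_eq0; apply: contrapT => /negP.
  move=> /separate[f [g [gV]]].
  by rewrite linearB linearP /= !gV linearP subrr eqxx.
pose U : {linear X -> Y} := HB.pack V (GRing.isLinear.Build _ _ _ _ _ Vlin).
exists U; split=> [//||x x1]; last by rewrite -Vsphere.
by apply/seteqP; split=> // y _; have [x] := Vonto y; exists x.
Qed.

End Isometry.

(** * Smooth points in separable almost-CL-spaces *)

(** The sequence is indexed by pairs (i, k), coded as integers: its term is a
    point of C within 1 / (k + 1) of the i-th point of the dense set, when there
    is one. *)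
Lemma separable_subset_dense_seq (R : realType) (X : normedModType R)
    (C : set X) : separable_space X -> C !=set0 ->
  exists2 c : X^nat, forall n, C (c n) &
    forall y (e : R), C y -> 0 < e -> exists n, `|y - c n| < e.
Proof.
move=> [D /countable_injP[code codeinj] denseD] [c0 Cc0].
pose near (i k : nat) := [set y | C y /\
  exists d, [/\ D d, code d = i & `|d - y| < k.+1%:R^-1 :> R]].
pose pt (ik : nat * nat) : X :=
  if pselect (exists y, near ik.1 ik.2 y) is left h then sval (cid h) else c0.
pose c n := if unpickle n is Some ik then pt ik else c0.
exists c => [n|y e Cy e0].
  rewrite /c; case: unpickle => [ik|//]; rewrite /pt.
  by case: pselect => [h|//]; case: (svalP (cid h)).
have e2 : 0 < e / 2 by lra.
have [k ke] : exists k, k.+1%:R^-1 < e / 2 :> R.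
  by have [k _ /(_ k (leqnn _))] := near_infty_natSinv_lt (PosNum e2); exists k.
have k0 : 0 < k.+1%:R^-1 :> R by rewrite invr_gt0.
have [||d [dy Dd]] := denseD (ball y k.+1%:R^-1); last 1 first.
- exists (pickle (code d, k)); rewrite /c pickleK /pt.
  move: dy; rewrite -ball_normE /= => dy.
  case: pselect => [h|[]]; last first.
    by exists y; split=> //; exists d; split=> //; rewrite distrC.
  have [_ [d' [Dd' cd' d'y]]] := svalP (cid h).
  have dd' : d' = d by apply: codeinj => //; rewrite inE.
  apply: le_lt_trans (ler_distD d _ _) _.
  rewrite dd' in d'y; rewrite /= in d'y *.
  by move: k.+1%:R^-1 ke dy d'y => r; lra.
- by exists y; exact: ballxx.
- exact: ball_open.
Qed.

Section HalvingSeries.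
Variables (R : realType) (X : completeNormedModType R) (c : X^nat).
Hypothesis c1 : forall n, `|c n| = 1.

(** The general term is 2^-(n+1): the weights are positive with sum 1. *)
Definition half_weight : R^nat := geometric 2^-1 2^-1.

Definition halving_sum : X := limn (series (fun n => half_weight n *: c n)).

Lemma half_weight_gt0 n : 0 < half_weight n.
Proof. by rewrite /half_weight /= mulr_gt0 ?exprn_gt0 ?invr_gt0. Qed.

Lemma cvg_half_weight : series half_weight @ \oo --> (1 : R).
Proof.
have := @cvg_geometric_series R 2^-1 2^-1.
have -> : 2^-1 * (1 - 2^-1)^-1 = 1 :> R by field.
by apply; rewrite ger0_norm; lra.
Qed.

Lemma norm_halving_terms :
  [normed series (fun n => half_weight n *: c n)] = series half_weight.
Proof.
apply/funext => n; apply: eq_bigr => k _.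
by rewrite /= normrZ c1 mulr1 ger0_norm// ltW// half_weight_gt0.
Qed.

Lemma is_cvg_halving : cvgn (series (fun n => half_weight n *: c n)).
Proof.
apply: normed_cvg; rewrite norm_halving_terms.
exact: (cvgP _ cvg_half_weight).
Qed.

Lemma norm_halving_sum : `|halving_sum| <= 1.
Proof.
have := @lim_series_norm R X (fun n => half_weight n *: c n).
rewrite norm_halving_terms (cvg_lim _ cvg_half_weight)//; apply.
exact: cvg_half_weight.
Qed.

Lemma cvg_functional_halving (h : {linear X -> R^o}) :
  (forall x, h x <= `|x|) ->
  series (fun n => half_weight n * h (c n)) @ \oo --> h halving_sum.
Proof.
move=> hle.
have -> : series (fun n => half_weight n * h (c n)) =
    h \o series (fun n => half_weight n *: c n).
  apply/funext => n /=; rewrite /series /= linear_sum.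
  by apply: eq_bigr => k _; rewrite linearZ.
apply: continuous_cvg; last exact: is_cvg_halving.
exact: contractive_continuous.
Qed.

(** A weighted average, with positive weights, of the numbers h (c n) <= 1
    reaches 1 only if all of them do: the deficit at the sum is at least the
    weighted deficit at any single c m. *)
Lemma halving_sum_eq1 (h : {linear X -> R^o}) : (forall x, h x <= `|x|) ->
  h halving_sum = 1 <-> forall n, h (c n) = 1.
Proof.
move=> hle; have cvgh := cvg_functional_halving hle; split=> [hs m|hc].
  rewrite hs in cvgh.
  have hc1 n : h (c n) <= 1 by rewrite -(c1 n).
  have cvg0 : (series half_weight -
      series (fun n => half_weight n * h (c n))) @ \oo --> (1 - 1 : R).
    exact: cvgB cvg_half_weight cvgh.
  have : half_weight m * (1 - h (c m)) <= 1 - 1.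
    rewrite -(cvg_lim _ cvg0)//; apply: limr_ge; first by apply: cvgP cvg0.
    (* Past rank m the partial sums of the deficits contain the m-th term. *)
    exists m.+1 => // n /= mn.
    rewrite !fctE /series /= -sumrB.
    under eq_bigr do rewrite -{1}[half_weight _]mulr1 -mulrBr.
    rewrite big_mkord (bigD1 (Ordinal mn))//= lerDl sumr_ge0// => i _.
    by rewrite mulr_ge0 ?subr_ge0// ltW// half_weight_gt0.
  rewrite subrr pmulr_rle0 ?half_weight_gt0// subr_le0 => h1.
  by apply/eqP; rewrite eq_le hc1.
have E : series (fun n => half_weight n * h (c n)) = series half_weight.
  by apply/funext => n; apply: eq_bigr => k _; rewrite hc mulr1.
rewrite E in cvgh.
rewrite -(cvg_lim _ cvgh)//; exact: cvg_lim cvg_half_weight.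
Qed.

End HalvingSeries.

(** A functional supporting the point x = sum of 2^-(n+1) *: c n supports all
    of C, so it is determined by its values on C and -C, whose closed convex
    hull is the ball. *)
Lemma separable_admits_smooth_point (R : realType)
    (X : completeNormedModType R) :
  almost_CL_space X -> separable_space X -> admits_smooth_point X.
Proof.
move=> aX sepX C mC; have C0 := almost_CL_nonempty aX mC.
have [CS cC _] := mC.
have [c Cc cdense] := separable_subset_dense_seq sepX C0.
have c1 n : `|c n| = 1 by exact: CS.
have [f [fle fC]] := supporting_functional C0 CS cC.
pose x := halving_sum c.
have fx : f x = 1 by apply/(halving_sum_eq1 c1 fle) => n; exact: fC.
have x1 : unit_sphere X x.
  by apply/eqP; rewrite eq_le norm_halving_sum//= -fx.
exists x.
  apply: maximal_convex_star => // v Cv; apply/eqP; rewrite eq_le.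
  apply/andP; split.
    by apply: le_trans (ler_normD _ _) _; rewrite (CS _ Cv : `|v| = 1) x1.
  by apply: le_trans (fle _); rewrite linearD fx fC.
split=> //; exists f; split.
  by split=> //; exact: contractive_dual_unit_sphere fle x1 fx.
move=> h0 [/dual_unit_sphere_contractive[h -> hle] hx] {h0}.
have hc n : h (c n) = 1 by move: n; apply/(halving_sum_eq1 c1 hle).
have hC y : C y -> h y = 1.
  move=> Cy; apply/eqP; rewrite -subr_eq0 -normr_le0.
  apply/ler_addgt0Pr => e e0; rewrite add0r.
  have [n yn] := cdense y e Cy e0.
  rewrite -(hc n) -linearB; apply: le_trans (contractive_abs hle _) _.
  exact: ltW.
have ball_eq y : `|y| <= 1 -> f y = h y.
  move=> y1; apply/eqP; rewrite -subr_eq0 -normr_le0.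
  apply/ler_addgt0Pr => e e0; rewrite add0r.
  have e2 : 0 < e / 2 by lra.
  have [p [q [a [b [[Cp Cq] _ _ yu]]]]] := almost_CL_approx aX mC y1 e2.
  set u := a *: p - b *: q in yu.
  have fhu : f u = h u.
    by rewrite /u !linearB !linearZ /= !(fC, hC).
  clearbody u.
  have := contractive_abs fle (y - u); have := contractive_abs hle (y - u).
  rewrite !linearB /= fhu => hyu fyu.
  apply: le_trans (ler_distD (h u) _ _) _.
  by rewrite [X in _ + X]distrC; lra.
apply/funext => y.
have [->|y0] := eqVneq y 0; first by rewrite !linear0.
have := ball_eq (`|y|^-1 *: y); rewrite norm_normalize// => /(_ (lexx _)).
rewrite !linearZ /= => /(congr1 (fun r => `|y| *: r)).
by rewrite !scalerA mulfV ?normr_eq0// !scale1r.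
Qed.

Theorem corollary2p8 (R : realType) (X : completeNormedModType R) :
  (almost_CL_space X -> admits_smooth_point X -> Mazur_Ulam_property X) /\
  (almost_CL_space X -> separable_space X ->
     admits_smooth_point X /\ Mazur_Ulam_property X).
Proof.
have smoothP : almost_CL_space X -> admits_smooth_point X ->
    Mazur_Ulam_property X.
  move=> aX sX Y T T_onto T_isom; exact: isom_linear_extension.
split=> // aX sepX.
by have sX := separable_admits_smooth_point aX sepX; split=> //; exact: smoothP.
Qed.
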